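(* Let $k\ge 1$ and let $\Lambda$ be a row-finite $k$-graph without sources, with path groupoid $\mathcal G_\Lambda$. Then the interior $\mathrm{Iso}(\mathcal G_\Lambda)^{\mathrm{o}}$ of the isotropy group bundle is closed in $\mathcal G_\Lambda$ if and only if $\Lambda^\infty_{p,q}=\varnothing$ for all $p\ne q\in\mathbb N^k$.
   Context: $\mathbb N$ denotes the nonnegative integers. All topological spaces are assumed second countable (in particular $\Lambda$ is countable). $k$-graphs. A $k$-graph is a small category $\Lambda$ with a functor $d:\Lambda\to\mathbb N^k$ (degree map) having the factorization property: if $\mu\in\Lambda$ and $d(\mu)=n+m$ with $n,m\in\mathbb N^k$, there are unique $\nu,\alpha\in\Lambda$ with $d(\nu)=n$, $d(\alpha)=m$, $s(\nu)=r(\alpha)$ and $\mu=\nu\alpha$. The product $\mu\nu$ is defined when $s(\mu)=r(\nu)$. Write $\Lambda^n=d^{-1}(n)$; $\Lambda^0$ is identified with the set of objects (vertices). For $A,B\subset\Lambda$, $AB=\{\mu\nu:\mu\in A,\nu\in B,s(\mu)=r(\nu)\}$; thus $v\Lambda^n=\{\mu\in\Lambda^n:r(\mu)=v\}$. $\Lambda$ is row-finite if $|v\Lambda^n|<\infty$ for all $v\in\Lambda^0$, $n\in\mathbb N^k$, and without sources if $v\Lambda^n\ne\varnothing$ for all such $v,n$. Infinite paths. $\Omega_k=\{(p,q)\in\mathbb N^k\times\mathbb N^k:p\le q\}$ is the $k$-graph with $\Omega_k^0=\mathbb N^k$, $r(p,q)=p$, $s(p,q)=q$, $d(p,q)=q-p$.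 An infinite path is a degree-preserving functor $x:\Omega_k\to\Lambda$; $\Lambda^\infty$ is the set of these. Write $x(p):=x(0,p)$ for $p\in\mathbb N^k$, and let $\sigma^p(x)\in\Lambda^\infty$ be the unique element with $x=x(p)\sigma^p(x)$. For $v\in\Lambda^0$, $v\Lambda^\infty=\{x\in\Lambda^\infty:x(0)=v\}$. For $\mu\in\Lambda$, $Z(\mu)=\{\mu x:x\in s(\mu)\Lambda^\infty\}$; these sets generate the topology of $\Lambda^\infty$. Path groupoid. $\mathcal G_\Lambda=\{(x,p-q,y)\in\Lambda^\infty\times\mathbb Z^k\times\Lambda^\infty:p,q\in\mathbb N^k,\ \sigma^p(x)=\sigma^q(y)\}$, with range $x$, source $y$, composition $(x,m,y)(y,m',z)=(x,m+m',z)$ and inverse $(x,m,y)^{-1}=(y,-m,x)$. Its topology is generated by the basic open sets $Z(\mu,\nu)=\{(\mu x,d(\mu)-d(\nu),\nu x):x\in s(\mu)\Lambda^\infty\}$ for $\mu,\nu\in\Lambda$ with $s(\mu)=s(\nu)$; it is a locally compact Hausdorff étale groupoid. $\mathrm{Iso}(\mathcal G_\Lambda)=\{(x,m,x)\in\mathcal G_\Lambda\}$, and $\mathrm{Iso}(\mathcal G_\Lambda)^{\mathrm{o}}$ is its interior in $\mathcal G_\Lambda$. Cycline pairs. A pair $(\mu,\nu)\in\Lambda\times\Lambda$ is a cycline pair if $s(\mu)=s(\nu)$ and $\mu x=\nu x$ for all $x\in s(\mu)\Lambda^\infty$. The sets $\Lambda^\infty_{p,q}$. For $p\ne q\in\mathbb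 N^k$, $\Lambda^\infty_{p,q}$ is the set of $x\in\Lambda^\infty$ such that (1) $\sigma^p(x)=\sigma^q(x)$; and (2) for all $p',q'\in\mathbb N^k$ with $p'-p=q'-q\in\mathbb N^k$, $(x(p'),x(q'))$ is not a cycline pair, and $(x(p')\mu,x(q')\mu)$ is a cycline pair for some $\mu\in\Lambda$ (with $r(\mu)=s(x(p'))=s(x(q'))$). *)

(* Defs.v *)
From HB Require Import structures.
From mathcomp Require Import all_boot all_order all_algebra.
From mathcomp Require Import all_classical topology.

Set Implicit Arguments.
Unset Strict Implicit.
Unset Printing Implicit Defensive.

Import GRing.Theory.
Local Open Scope classical_set_scope.
Local Open Scope ring_scope.

(* Small categories are written in the arrows-compose-as-paths convention:
   [catcomp mu nu] is the product mu nu, meaningful when s(mu) = r(nu).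
   [catcomp] is a total function whose values on non-composable pairs are
   unconstrained; every use of it is guarded by s(mu) = r(nu). *)
Record smallcat : Type := SmallCat {
  obj : Type;
  mor : Type;
  rng : mor -> obj;
  src : mor -> obj;
  idmor : obj -> mor;
  catcomp : mor -> mor -> mor;
  rng_id : forall v, rng (idmor v) = v;
  src_id : forall v, src (idmor v) = v;
  rng_comp : forall mu nu, src mu = rng nu -> rng (catcomp mu nu) = rng mu;
  src_comp : forall mu nu, src mu = rng nu -> src (catcomp mu nu) = src nu;
  comp_idl : forall mu, catcomp (idmor (rng mu)) mu = mu;
  comp_idr : forall mu, catcomp mu (idmor (src mu)) = mu;
  compA : forall la mu nu, src la = rng mu -> src mu = rng nu ->
    catcomp la (catcomp mu nu) = catcomp (catcomp la mu) nu
}.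

Arguments rng {s} _.
Arguments src {s} _.
Arguments idmor {s} _.
Arguments catcomp {s} _ _.

Record functor (C D : smallcat) : Type := Functor {
  fobj : obj C -> obj D;
  fmor : mor C -> mor D;
  rng_fmor : forall a, rng (fmor a) = fobj (rng a);
  src_fmor : forall a, src (fmor a) = fobj (src a);
  fmor_id : forall v, fmor (idmor v) = idmor (fobj v);
  fmor_comp : forall a b, src a = rng b ->
    fmor (catcomp a b) = catcomp (fmor a) (fmor b)
}.

Notation "''Nat^' k" := {ffun 'I_k -> nat} (at level 8, k at level 2).
Notation "''Int^' k" := {ffun 'I_k -> int} (at level 8, k at level 2).

Definition leN k (p q : 'Nat^k) : bool := [forall i, (p i <= q i)%N].

Definition subN k (q p : 'Nat^k) : 'Nat^k := [ffun i => (q i - p i)%N].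

Definition toZ k (p : 'Nat^k) : 'Int^k := [ffun i => (p i)%:Z].

(* [deg_id] and [deg_comp] say that d is a functor into the one-object
   category N^k. *)
Record kgraph (k : nat) : Type := KGraph {
  kcat :> smallcat;
  deg : mor kcat -> 'Nat^k;
  deg_id : forall v, deg (idmor v) = 0;
  deg_comp : forall mu nu, src mu = rng nu ->
    deg (catcomp mu nu) = deg mu + deg nu;
  factorization : forall mu n m, deg mu = n + m ->
    exists! na : mor kcat * mor kcat,
      [/\ deg na.1 = n, deg na.2 = m, src na.1 = rng na.2
        & mu = catcomp na.1 na.2]
}.

Arguments deg {k} {L} _ : rename.

Section NatVectors.
Variable k : nat.
Implicit Types p q r : 'Nat^k.

Lemma leNP p q : reflect (forall i, (p i <= q i)%N) (leN p q).
Proof. exact: forallP. Qed.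

Lemma leN_refl p : leN p p.
Proof. by apply/leNP => i. Qed.

Lemma leN_trans q p r : leN p q -> leN q r -> leN p r.
Proof. by move=> /leNP pq /leNP qr; apply/leNP => i; exact: leq_trans (qr i). Qed.

Lemma leN0 p : leN 0 p.
Proof. by apply/leNP => i; rewrite ffunE. Qed.

Lemma addNE p q i : (p + q) i = (p i + q i)%N.
Proof. by rewrite ffunE. Qed.

Lemma leN_add p q n : leN p q -> leN (p + n) (q + n).
Proof. by move=> /leNP pq; apply/leNP => i; rewrite !addNE leq_add2r. Qed.

Lemma leN_addr p q : leN p (p + q).
Proof. by apply/leNP => i; rewrite addNE leq_addr. Qed.

Lemma subN0 p : subN p 0 = p.
Proof. by apply/ffunP => i; rewrite !ffunE subn0. Qed.

Lemma subNn p : subN p p = 0.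
Proof. by apply/ffunP => i; rewrite !ffunE subnn. Qed.

Lemma subNK p q : leN p q -> p + subN q p = q.
Proof.
by move=> /leNP pq; apply/ffunP => i; rewrite addNE ffunE subnKC.
Qed.

Lemma addNI p q r : p + q = p + r -> q = r.
Proof.
move=> /ffunP e; apply/ffunP => i.
by move: (e i); rewrite !addNE => /addnI.
Qed.

Lemma subN_add2r n p q : subN (q + n) (p + n) = subN q p.
Proof. by apply/ffunP => i; rewrite !ffunE; exact: subnDr. Qed.

End NatVectors.

Section Omega.
Variable k : nat.

Definition omega_mor : Type := {pq : 'Nat^k * 'Nat^k | leN pq.1 pq.2}.

Definition oarr (p q : 'Nat^k) (h : leN p q) : omega_mor :=
  @exist _ (fun pq : 'Nat^k * 'Nat^k => leN pq.1 pq.2) (p, q) h.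

(* (p,q)(q,r) = (p,r); the default value is only reached on pairs that are
   not composable. *)
Definition omega_comp (a b : omega_mor) : omega_mor :=
  insubd a ((val a).1, (val b).2).

Definition omega_rng (a : omega_mor) := (val a).1.
Definition omega_src (a : omega_mor) := (val a).2.
Definition omega_id (p : 'Nat^k) := oarr (leN_refl p).

Lemma val_omega_comp (a b : omega_mor) : omega_src a = omega_rng b ->
  val (omega_comp a b) = ((val a).1, (val b).2).
Proof.
move=> ab; rewrite /omega_comp val_insubd ifT //=.
by apply: leN_trans (valP a) _; rewrite [X in leN X _]ab; exact: valP b.
Qed.

Lemma omega_rng_comp a b : omega_src a = omega_rng b -> omega_rng (omega_comp a b) = omega_rng a.
Proof. by move=> ab; rewrite /omega_rng val_omega_comp. Qed.

Lemma omega_src_comp a b : omega_src a = omega_rng b -> omega_src (omega_comp a b) = omega_src b.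
Proof. by move=> ab; rewrite /omega_src val_omega_comp. Qed.

Lemma omega_comp_idl a : omega_comp (omega_id (omega_rng a)) a = a.
Proof. by case: a => -[p q] pq; apply: val_inj; rewrite val_omega_comp. Qed.

Lemma omega_comp_idr a : omega_comp a (omega_id (omega_src a)) = a.
Proof. by case: a => -[p q] pq; apply: val_inj; rewrite val_omega_comp. Qed.

Lemma omega_compA a b c : omega_src a = omega_rng b -> omega_src b = omega_rng c ->
  omega_comp a (omega_comp b c) = omega_comp (omega_comp a b) c.
Proof.
move=> ab bc; have a_bc : omega_src a = omega_rng (omega_comp b c) by rewrite omega_rng_comp.
have ab_c : omega_src (omega_comp a b) = omega_rng c by rewrite omega_src_comp.
by apply: val_inj; rewrite !val_omega_comp.
Qed.

Definition omega_cat : smallcat :=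
  @SmallCat 'Nat^k omega_mor omega_rng omega_src omega_id omega_comp
    (fun=> erefl) (fun=> erefl) omega_rng_comp omega_src_comp omega_comp_idl omega_comp_idr omega_compA.

Definition omega_deg (a : mor omega_cat) : 'Nat^k := subN (val a).2 (val a).1.

Lemma omega_deg_id v : omega_deg (idmor v) = 0.
Proof. exact: subNn. Qed.

Lemma omega_deg_comp a b : src a = rng b -> omega_deg (catcomp a b) = omega_deg a + omega_deg b.
Proof.
case: a b => [[p q] /= pq] [[q' r] /= qr] /= qq'; rewrite /omega_deg val_omega_comp //=.
have {}qq' : q = q' := qq'; subst q'.
by apply: (@addNI _ p); rewrite addrA !subNK //; exact: leN_trans qr.
Qed.

Lemma omega_factorization (a : mor omega_cat) n m : omega_deg a = n + m ->
  exists! bc : mor omega_cat * mor omega_cat,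
    [/\ omega_deg bc.1 = n, omega_deg bc.2 = m, src bc.1 = rng bc.2
      & a = catcomp bc.1 bc.2].
Proof.
case: a => [[p q] /= pq]; rewrite /omega_deg /= => e.
have eq : q = p + n + m by rewrite -addrA -e subNK.
have h1 : leN p (p + n) := leN_addr _ _.
have h2 : leN (p + n) q by rewrite eq leN_addr.
exists (oarr h1, oarr h2); split.
  split=> //=.
  - by apply: (@addNI _ p); rewrite subNK.
  - by apply: (@addNI _ (p + n)); rewrite subNK.
  - by apply: val_inj; rewrite val_omega_comp.
move=> [[[p1 q1] /= pq1] [[p2 q2] /= pq2]] [] /= d1 d2 e12 /(congr1 val).
rewrite val_omega_comp //= => -[e1 e2].
have {}e12 : q1 = p2 := e12.
have e3 : q1 = p + n by rewrite -d1 e1 subNK.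
by congr (_, _); apply: val_inj; rewrite /= -?e12 e3 ?e1 ?e2.
Qed.

Definition Omega : kgraph k := KGraph omega_deg_id omega_deg_comp omega_factorization.

End Omega.

Section KGraph.
Variables (k : nat) (L : kgraph k).

Definition row_finite : Prop := forall (v : obj L) (n : 'Nat^k),
  finite_set [set mu : mor L | rng mu = v /\ deg mu = n].

Definition without_sources : Prop := forall (v : obj L) (n : 'Nat^k),
  [set mu : mor L | rng mu = v /\ deg mu = n] !=set0.

Record inf_path : Type := InfPath {
  path_functor :> functor (Omega k) L;
  path_deg : forall a : mor (Omega k), deg (fmor path_functor a) = deg a
}.

HB.instance Definition _ := gen_eqMixin inf_path.
HB.instance Definition _ := gen_choiceMixin inf_path.

Implicit Types (x y z : inf_path) (mu nu : mor L) (p q : 'Nat^k).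

Definition path_init x p : mor L := fmor x (oarr (leN0 p)).

Definition path_rng x : obj L := fobj x (0 : 'Nat^k).

Section Shift.
Variables (n : 'Nat^k) (x : inf_path).

Definition shift_arr (a : mor (Omega k)) : mor (Omega k) := oarr (leN_add n (valP a)).

Lemma shift_arr_id v : shift_arr (idmor v) = idmor (v + n : obj (Omega k)).
Proof. by apply: val_inj. Qed.

Lemma shift_arr_comp a b : src a = rng b -> shift_arr (catcomp a b) = catcomp (shift_arr a) (shift_arr b).
Proof.
move=> ab; have ab' : src (shift_arr a) = rng (shift_arr b) by congr (_ + _).
by apply: val_inj; rewrite /= !val_omega_comp.
Qed.

Lemma shift_rng a :
  rng (fmor x (shift_arr a)) = fobj x ((rng a : 'Nat^k) + n : obj (Omega k)).
Proof. by rewrite rng_fmor. Qed.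

Lemma shift_src a :
  src (fmor x (shift_arr a)) = fobj x ((src a : 'Nat^k) + n : obj (Omega k)).
Proof. by rewrite src_fmor. Qed.

Lemma shift_id v :
  fmor x (shift_arr (idmor v)) = idmor (fobj x ((v : 'Nat^k) + n : obj (Omega k))).
Proof. by rewrite shift_arr_id fmor_id. Qed.

Lemma shift_comp a b : src a = rng b ->
  fmor x (shift_arr (catcomp a b)) = catcomp (fmor x (shift_arr a)) (fmor x (shift_arr b)).
Proof. by move=> ab; rewrite shift_arr_comp // fmor_comp //; congr (_ + _). Qed.

Lemma shift_deg a : deg (fmor x (shift_arr a)) = deg a.
Proof. by rewrite path_deg; exact: subN_add2r. Qed.

(* sigma^n(x)(p,q) = x(p+n,q+n); [shiftP] and [shift_unique] below
   characterize it as the unique z with x = x(n)z. *)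
Definition shift : inf_path :=
  @InfPath (@Functor (Omega k) L (fun p => fobj x ((p : 'Nat^k) + n))
    (fun a => fmor x (shift_arr a)) shift_rng shift_src shift_id shift_comp) shift_deg.

End Shift.

(* mu x is the y with y(d(mu)) = mu and sigma^(d(mu))(y) = x; it exists and is
   unique when s(mu) = r(x), see [pconcatP] and [pconcat_unique].  The default
   value x is only reached when s(mu) <> r(x). *)
Definition pconcat mu x : inf_path :=
  xget x [set y | path_init y (deg mu) = mu /\ shift (deg mu) y = x].

Lemma factor_inj (a a' b b' : mor L) : src a = rng b -> src a' = rng b' ->
  deg a = deg a' -> catcomp a b = catcomp a' b' -> a = a' /\ b = b'.
Proof.
move=> ab ab' daa' e.
have dbb' : deg b = deg b'.
  by apply: (@addNI _ (deg a)); rewrite {2}daa' -!deg_comp // e.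
have [c [_ cU]] := factorization (deg_comp ab).
have := cU (a', b'); rewrite (cU (a, b)); last by split.
by move=> /(_ (And4 (esym daa') (esym dbb') ab' e)) [].
Qed.

Lemma inf_path_ext x y :
  (forall a : mor (Omega k), fmor x a = fmor y a) -> x = y.
Proof.
case: x y => [[xo xm xr xs xi xc] xd] [[yo ym yr ys yi yc] yd] /= xy.
have m_eq : xm = ym by exact/funext.
subst ym.
have o_eq : xo = yo.
  by apply/funext => v; exact: etrans (esym (xr (idmor v))) (yr (idmor v)).
subst yo; have F_eq : Functor xr xs xi xc = Functor yr ys yi yc.
  by congr Functor; exact: Prop_irrelevance.
move: xd yd; rewrite F_eq => xd yd; congr InfPath; exact: Prop_irrelevance.
Qed.

Lemma oarr_comp p q r (pq : leN p q) (qr : leN q r) (pr : leN p r) :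
  oarr pr = catcomp (oarr pq : mor (Omega k)) (oarr qr).
Proof. by apply: val_inj; rewrite /= val_omega_comp. Qed.

Lemma path_init_deg x p : deg (path_init x p) = p.
Proof. by rewrite path_deg; exact: subN0. Qed.

Lemma path_init_rng x p : rng (path_init x p) = path_rng x.
Proof. exact: rng_fmor. Qed.

Lemma path_init_src x p : src (path_init x p) = fobj x (p : obj (Omega k)).
Proof. exact: src_fmor. Qed.

Lemma path_init_comp x p q (pq : leN p q) :
  path_init x q = catcomp (path_init x p) (fmor x (oarr pq)).
Proof.
rewrite /path_init (oarr_comp (leN0 p) pq (leN0 q)).
by rewrite (@fmor_comp _ _ x (oarr (leN0 p)) (oarr pq)).
Qed.

Lemma shift_init x n q :
  path_init x (q + n) = catcomp (path_init x n) (path_init (shift n x) q).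
Proof.
have nqn : leN n (q + n) by rewrite addrC leN_addr.
rewrite (path_init_comp x nqn); congr (catcomp _ (fmor x _)).
by apply: val_inj; rewrite /= add0r.
Qed.

Lemma path_rng_shift x n : path_rng (shift n x) = src (path_init x n).
Proof. by rewrite path_init_src /path_rng /= add0r. Qed.

Lemma path_init_inj x y : (forall q, path_init x q = path_init y q) -> x = y.
Proof.
move=> xy; apply: inf_path_ext => -[[p q] /= pq].
rewrite -/(oarr pq); have := xy q; rewrite !(path_init_comp _ pq).
by case/factor_inj; rewrite ?path_init_deg ?rng_fmor ?src_fmor.
Qed.

Lemma inf_path_of_inits (y : 'Nat^k -> mor L) : (forall q, deg (y q) = q) ->
  (forall p q, leN p q ->
    exists t, src (y p) = rng t /\ y q = catcomp (y p) t) ->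
  exists z, forall q, path_init z q = y q.
Proof.
move=> yd yt.
have {yt} /choice [T TP] (a : mor (Omega k)) : exists t : mor L,
    src (y (rng a)) = rng t /\ y (src a) = catcomp (y (rng a)) t.
  exact: yt (valP a).
have Tr a : rng (T a) = src (y (rng a)) by have [->] := TP a.
have Ts a : src (T a) = src (y (src a)).
  by have [e ->] := TP a; rewrite src_comp.
have Ti v : T (idmor v) = idmor (src (y v)).
  have [e1 e2] := TP (idmor v).
  by case: (@factor_inj (y v) (y v) (T (idmor v)) (idmor (src (y v))));
    rewrite ?rng_id // comp_idr -[LHS]e2.
have Tc a b : src a = rng b -> T (catcomp a b) = catcomp (T a) (T b).
  move=> ab; have [e1 e2] := TP (catcomp a b).
  have Tab : src (T a) = rng (T b) by rewrite Ts Tr ab.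
  rewrite rng_comp // in e1 e2; rewrite src_comp // in e2.
  case: (@factor_inj (y (rng a)) (y (rng a)) (T (catcomp a b))
    (catcomp (T a) (T b))) => //; first by rewrite rng_comp // Tr.
  have [a1 a2] := TP a; have [b1 b2] := TP b.
  by rewrite -e2 compA // -a2 ab.
have Td a : deg (T a) = deg a.
  apply: (@addNI _ (deg (y (rng a)))); rewrite -deg_comp ?Tr // -(TP a).2 !yd.
  by rewrite [RHS]subNK //; exact: valP a.
pose z := @InfPath (@Functor (Omega k) L (fun p => src (y p)) T Tr Ts Ti Tc) Td.
exists z => q; have [e1 e2] := TP (oarr (leN0 q)).
have y0 : y 0 = idmor (rng (y 0)).
  case: (@factor_inj (y 0) (idmor (rng (y 0))) (idmor (src (y 0))) (y 0)) => //.
  - by rewrite rng_id.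
  - by rewrite src_id.
  - by rewrite deg_id yd.
  - by rewrite comp_idl comp_idr.
have {}e1 : src (y 0) = rng (T (oarr (leN0 q))) := e1.
have {}e2 : y q = catcomp (y 0) (T (oarr (leN0 q))) := e2.
have s0 : src (y 0) = rng (y 0) by rewrite y0 src_id rng_id.
by rewrite e2 y0 -s0 e1 comp_idl.
Qed.

Lemma pconcat_unique mu x y z :
  path_init y (deg mu) = mu -> shift (deg mu) y = x ->
  path_init z (deg mu) = mu -> shift (deg mu) z = x -> y = z.
Proof.
move=> ymu yx zmu zx; apply: path_init_inj => q.
have : path_init y (q + deg mu) = path_init z (q + deg mu).
  by rewrite !shift_init ymu yx zmu zx.
have h : leN q (q + deg mu) := leN_addr _ _.
rewrite !(path_init_comp _ h).
by case/factor_inj; rewrite ?path_init_deg ?rng_fmor ?src_fmor.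
Qed.

Lemma pconcatP mu x : path_rng x = src mu ->
  path_init (pconcat mu x) (deg mu) = mu /\ shift (deg mu) (pconcat mu x) = x.
Proof.
move=> xmu; pose la q := catcomp mu (path_init x q).
have mux q : src mu = rng (path_init x q) by rewrite path_init_rng.
have lad q : deg (la q) = q + deg mu.
  by rewrite deg_comp // path_init_deg addrC.
have las p q (pq : leN p q) : src (la p) = rng (fmor x (oarr pq)) /\
    la q = catcomp (la p) (fmor x (oarr pq)).
  have e : src (path_init x p) = rng (fmor x (oarr pq)).
    by rewrite path_init_src rng_fmor.
  by rewrite /la src_comp // -compA // -path_init_comp.
have /choice [H HP] q : exists ht : mor L * mor L, [/\ deg ht.1 = q,
    src ht.1 = rng ht.2 & la q = catcomp ht.1 ht.2].
  by have [ht [[? _ ? ?] _]] := factorization (lad q); exists ht.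
have [z zP] : exists z, forall q, path_init z q = (H q).1.
  apply: inf_path_of_inits => [q|p q pq]; first by have [] := HP q.
  have [dp sp lp] := HP p; have [dq sq lq] := HP q.
  have [sx lx] := las p q pq.
  have [[a b] [[/= da _ ab qab] _]] :=
    factorization (etrans dq (esym (subNK pq))).
  have tx : src (H p).2 = rng (fmor x (oarr pq)).
    by rewrite -sx lp src_comp.
  have bq : src b = rng (H q).2 by rewrite -sq qab src_comp.
  have [] := @factor_inj (H p).1 a (catcomp (H p).2 (fmor x (oarr pq)))
    (catcomp b (H q).2).
  - by rewrite rng_comp.
  - by rewrite rng_comp.
  - by rewrite dp da.
  - by rewrite !compA // -lp -lx lq qab.
  by move=> pa _; exists b; rewrite pa.
have zl q : path_init z (q + deg mu) = la q.
  have hq : leN q (q + deg mu) := leN_addr _ _.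
  have [sl ll] := las _ _ hq.
  have [d1 s1 l1] := HP (q + deg mu).
  rewrite zP.
  have [] := @factor_inj (H (q + deg mu)).1 (la q) (H (q + deg mu)).2
    (fmor x (oarr hq)) => //.
  - by rewrite d1 lad.
  - by rewrite -l1.
have zmu : path_init z (deg mu) = mu.
  rewrite -[X in path_init z X]add0r zl /la.
  suff -> : path_init x 0 = idmor (src mu) by rewrite comp_idr.
  rewrite -xmu -fmor_id; congr (fmor x _); exact: val_inj.
apply: (@xgetPex _ x [set y | path_init y (deg mu) = mu /\ shift (deg mu) y = x]).
exists z; split => //; apply: path_init_inj => q.
have := zl q; rewrite shift_init zmu => /factor_inj[] //.
by rewrite path_init_rng path_rng_shift zmu.
Qed.

Lemma shiftP n x : pconcat (path_init x n) (shift n x) = x.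
Proof.
have [] := pconcatP (path_rng_shift x n); rewrite path_init_deg => e1 e2.
by apply: (@pconcat_unique (path_init x n) (shift n x)); rewrite ?path_init_deg.
Qed.

Lemma shift_unique n x z : path_rng z = src (path_init x n) ->
  pconcat (path_init x n) z = x -> z = shift n x.
Proof. by move=> /pconcatP[_]; rewrite path_init_deg => + e; rewrite e. Qed.

Record path_groupoid : Type := PathGroupoid {
  gtriple : inf_path * 'Int^k * inf_path;
  gtripleP : exists p q : 'Nat^k, gtriple.1.2 = toZ p - toZ q /\
    shift p gtriple.1.1 = shift q gtriple.2
}.

HB.instance Definition _ := gen_eqMixin path_groupoid.
HB.instance Definition _ := gen_choiceMixin path_groupoid.

Definition grng (g : path_groupoid) : inf_path := (gtriple g).1.1.
Definition gsrc (g : path_groupoid) : inf_path := (gtriple g).2.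

(* Z(mu,nu) = {(mu x, d(mu) - d(nu), nu x) : x in s(mu)Lambda^infty} *)
Definition cylinder2 mu nu : set path_groupoid :=
  [set g | exists2 x, path_rng x = src mu &
    gtriple g = (pconcat mu x, toZ (deg mu) - toZ (deg nu), pconcat nu x)].

Lemma cylinder2_in_groupoid mu nu x :
  src mu = src nu -> path_rng x = src mu ->
  exists2 g, cylinder2 mu nu g &
    gtriple g = (pconcat mu x, toZ (deg mu) - toZ (deg nu), pconcat nu x).
Proof.
move=> munu xmu; have [_ smu] := pconcatP xmu.
have [_ snu] := pconcatP (etrans xmu munu).
have h : exists p q : 'Nat^k, toZ (deg mu) - toZ (deg nu) = toZ p - toZ q /\
    shift p (pconcat mu x) = shift q (pconcat nu x).
  by exists (deg mu), (deg nu); rewrite smu snu.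
by exists (@PathGroupoid (_, _, _) h) => //; exists x.
Qed.

Definition cylinder2s : set (set path_groupoid) :=
  [set Z | exists mu nu, src mu = src nu /\ Z = cylinder2 mu nu].

HB.instance Definition _ :=
  isSubBaseTopological.Build path_groupoid cylinder2s id.

Definition Iso : set path_groupoid := [set g | grng g = gsrc g].

Definition cycline_pair mu nu : Prop :=
  src mu = src nu /\
  forall x, path_rng x = src mu -> pconcat mu x = pconcat nu x.

Definition inf_path_pq p q : set inf_path :=
  [set x | shift p x = shift q x /\
    forall p' q' n : 'Nat^k, p' = p + n -> q' = q + n ->
      ~ cycline_pair (path_init x p') (path_init x q') /\
      exists mu : mor L,
        [/\ rng mu = src (path_init x p'), rng mu = src (path_init x q')
          & cycline_pair (catcomp (path_init x p') mu)
                         (catcomp (path_init x q') mu)]].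

End KGraph.

Arguments Iso {k} L.
Arguments inf_path_pq {k} L p q.

(* Main.v *)
Require Import Defs.
From mathcomp Require Import all_boot all_order all_algebra.
From mathcomp Require Import all_classical topology.

Local Open Scope classical_set_scope.

(** Write an element of the path groupoid as g = (x, p - q, y) with
sigma^p(x) = sigma^q(y).  The cylinders Z(x(p+n), y(q+n)), for n in N^k, form
a neighbourhood base at g ([nbhs_tail_cylinder]): if g lies in Z(mu,nu), then
for every n >= d(mu) both legs extend mu and nu by one and the same path, the
degrees matching because p - q = d(mu) - d(nu).  When s(mu) = s(nu), the
inclusion of Z(mu,nu) in the isotropy says exactly that (mu,nu) is a cycline
pair.  Hence g is in the interior of the isotropy iff (x(p+n), y(q+n)) is a
cycline pair for some n ([interior_IsoP]).

The second condition defining Lambda^infty_{p,q} is therefore topological.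
That no (x(p+n), x(q+n)) is a cycline pair says that (x, p - q, x) is not in
the interior of the isotropy.  That each of these pairs becomes a cycline pair
after right multiplication by some mu says that every basic neighbourhood
of (x, p - q, x) contains a smaller cylinder made of isotropy, hence meets the
interior; such a cylinder is nonempty because every vertex receives an infinite
path ([path_rng_surj]), the graph having no sources.  So a point of
Lambda^infty_{p,q} is the same thing as a point of the closure of the interior
that is not in the interior.  Two facts complete the converse direction: the
isotropy is closed ([closed_Iso]), so a limit of interior points has the
form (x, p - q, x), and units are interior, so that p <> q for a limit outside
the interior. *)

Set Implicit Arguments.
Unset Strict Implicit.
Unset Printing Implicit Defensive.

Import GRing.Theory.
Local Open Scope ring_scope.
(* Here catcomp and factor_inj mean composition and unique factorization in a
k-graph, not their namesakes on functions and on affine maps. *)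
Import Defs.

(** * Degrees *)

Section Degrees.
Variable k : nat.
Implicit Types p q n : 'Nat^k.

Lemma toZ_subE p q i : (toZ p - toZ q) i = (p i)%:Z - (q i)%:Z.
Proof. by rewrite !ffunE. Qed.

Lemma toZ_subD p q n : toZ (p + n) - toZ (q + n) = toZ p - toZ q.
Proof.
apply/ffunP => i.
by rewrite !toZ_subE !addNE !PoszD opprD addrACA subrr addr0.
Qed.

Lemma toZ_sub_eq p q p' q' :
  toZ p - toZ q = toZ p' - toZ q' -> p + q' = p' + q.
Proof.
move=> /ffunP e; apply/ffunP => i; move: (e i); rewrite !toZ_subE !addNE.
by move=> /eqP; rewrite subr_eq addrAC eq_sym subr_eq -!PoszD => /eqP[].
Qed.

Lemma leN_addlW p q n : leN p q -> leN p (n + q).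
Proof. by move=> pq; rewrite addrC; apply: leN_trans pq (leN_addr _ _). Qed.

End Degrees.

Section PathGroupoid.
Variables (k : nat) (L : kgraph k).
Implicit Types (x y z : inf_path L) (mu nu t : mor L) (p q n : 'Nat^k).
Implicit Types g h : path_groupoid L.

(** * Infinite paths *)

Lemma shiftD n p x : shift n (shift p x) = shift (n + p) x.
Proof.
by apply: inf_path_ext => a /=; congr (fmor x _); apply: val_inj;
  rewrite /= !addrA.
Qed.

Lemma path_initD x p n :
  path_init x (p + n) = catcomp (path_init x p) (path_init (shift p x) n).
Proof. by rewrite addrC shift_init. Qed.

Lemma src_path_init x p : src (path_init x p) = path_rng (shift p x).
Proof. by rewrite path_rng_shift. Qed.

Lemma path_init_le x y p q :
  leN p q -> path_init x q = path_init y q -> path_init x p = path_init y p.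
Proof.
move=> pq; rewrite !(path_init_comp _ pq).
by case/factor_inj; rewrite ?path_init_deg ?rng_fmor ?src_fmor.
Qed.

Lemma path_rng_pconcat mu x :
  path_rng x = src mu -> path_rng (pconcat mu x) = rng mu.
Proof. by case/pconcatP => e _; rewrite -{2}e path_init_rng. Qed.

Lemma path_init_pconcat mu x n : path_rng x = src mu ->
  path_init (pconcat mu x) (deg mu + n) = catcomp mu (path_init x n).
Proof. by case/pconcatP => e1 e2; rewrite path_initD e1 e2. Qed.

Lemma pconcat_cat mu t x : src mu = rng t -> path_rng x = src t ->
  pconcat (catcomp mu t) x = pconcat mu (pconcat t x).
Proof.
move=> mt xt.
have xmt : path_rng x = src (catcomp mu t) by rewrite src_comp.
have txm : path_rng (pconcat t x) = src mu by rewrite path_rng_pconcat.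
have [i1 s1] := pconcatP xmt; have [i2 s2] := pconcatP txm.
have [i3 s3] := pconcatP xt.
apply: (pconcat_unique i1 s1); rewrite deg_comp //.
  by rewrite path_init_pconcat // i3.
by rewrite addrC -shiftD s2 s3.
Qed.

Definition is_prefix mu nu : Prop :=
  exists t, src mu = rng t /\ nu = catcomp mu t.

Lemma is_prefix_refl mu : is_prefix mu mu.
Proof. by exists (idmor (src mu)); rewrite rng_id comp_idr. Qed.

Lemma is_prefix_trans nu mu la :
  is_prefix mu nu -> is_prefix nu la -> is_prefix mu la.
Proof.
move=> [t [mt ->]] [u [+ ->]]; rewrite src_comp // => tu.
by exists (catcomp t u); rewrite rng_comp // compA.
Qed.

Lemma prefix_exists mu n : leN n (deg mu) ->
  exists nu, deg nu = n /\ is_prefix nu mu.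
Proof.
move=> /subNK e; have [[a b] [[/= da _ ab ->] _]] := factorization (esym e).
by exists a; split=> //; exists b.
Qed.

(** Prefixes of a common path are nested as soon as their degrees are: both
come from the unique factorization of the longer one. *)
Lemma is_prefix_common mu nu la : is_prefix mu la -> is_prefix nu la ->
  leN (deg mu) (deg nu) -> is_prefix mu nu.
Proof.
move=> mula [t [nut e]] /prefix_exists[mu' [d [u [mu'u e']]]].
have [s [mus e2]] := mula.
have ut : src u = rng t by rewrite -nut e' src_comp.
have [-> _] : mu = mu' /\ s = catcomp u t; last by exists u.
by apply: factor_inj; rewrite ?rng_comp // compA // -e' -e.
Qed.

(** Prolonging repeatedly by a path of degree (1,...,1) gives a nested sequence
whose degrees exceed every element of N^k; its prefixes are the initial
segments of an infinite path. *)
Lemma path_rng_surj : without_sources L ->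
  forall v : obj L, exists x, path_rng x = v.
Proof.
move=> Lns v; pose one : 'Nat^k := [ffun=> 1%N].
have /choice[e eP] w : exists mu : mor L, rng mu = w /\ deg mu = one.
  by have [mu] := Lns w one; exists mu.
pose P j := iter j (fun mu => catcomp mu (e (src mu))) (idmor v).
have PS j : P j.+1 = catcomp (P j) (e (src (P j))) by [].
have Pe j : src (P j) = rng (e (src (P j))) by have [->] := eP (src (P j)).
have Pdeg j i : deg (P j) i = j.
  elim: j => [|j IH]; first by rewrite deg_id ffunE.
  by rewrite PS deg_comp // addNE IH (eP _).2 ffunE addn1.
have Prng j : rng (P j) = v.
  by elim: j => [|j IH]; rewrite ?rng_id // PS rng_comp.
have Pnest i j : (i <= j)%N -> is_prefix (P i) (P j).
  move=> /subnK <-; elim: (j - i)%N => [|m IH]; first exact: is_prefix_refl.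
  by apply: is_prefix_trans IH _; exists (e (src (P (m + i)%N))).
have /choice[y yP] q : exists mu,
    deg mu = q /\ is_prefix mu (P (\sum_i q i)%N).
  apply: prefix_exists; apply/leNP => i.
  by rewrite Pdeg (bigD1 i) //= leq_addr.
have [p q pq|x xy] := @inf_path_of_inits _ _ y (fun q => (yP q).1).
  have [dp yp] := yP p; have [dq yq] := yP q.
  apply: is_prefix_common yq _; last by rewrite dp dq.
  apply: is_prefix_trans yp (Pnest _ _ _).
  by apply: leq_sum => i _; exact: (leNP _ _ pq).
exists x; rewrite -(path_init_rng x 0) xy.
have [_ [t [yt Pt]]] := yP 0.
by rewrite -(rng_comp yt) -Pt Prng.
Qed.

(** * Cylinders in the path groupoid *)

Definition gdeg g : 'Int^k := (gtriple g).1.2.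

Lemma gtripleE g : gtriple g = (grng g, gdeg g, gsrc g).
Proof. by rewrite /grng /gdeg /gsrc; case: (gtriple g) => -[]. Qed.

(** The degree and the two legs of g do not determine (p,q): translating a
witness by n gives another one ([witnessD]).  That freedom is what makes tail
cylinders shrink. *)
Definition witness p q g : Prop :=
  gdeg g = toZ p - toZ q /\ shift p (grng g) = shift q (gsrc g).

Lemma witness_exists g : exists p q, witness p q g.
Proof. by have [p [q [e s]]] := gtripleP g; exists p, q. Qed.

Lemma witnessD p q n g : witness p q g -> witness (p + n) (q + n) g.
Proof.
by case=> e s; split; rewrite ?toZ_subD // ![_ + n]addrC -!shiftD s.
Qed.

Lemma witness_src p q g : witness p q g ->
  src (path_init (grng g) p) = src (path_init (gsrc g) q).
Proof. by case=> _ s; rewrite !src_path_init s. Qed.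

Lemma cylinder2P mu nu g : src mu = src nu ->
  cylinder2 mu nu g <-> [/\ witness (deg mu) (deg nu) g,
    path_init (grng g) (deg mu) = mu & path_init (gsrc g) (deg nu) = nu].
Proof.
move=> munu; split=> [[x xmu]|[[e s] imu inu]].
  rewrite gtripleE => -[er ed es]; rewrite /witness er ed es.
  have [-> ->] := pconcatP xmu.
  by have [-> ->] := pconcatP (etrans xmu munu).
exists (shift (deg mu) (grng g)); first by rewrite path_rng_shift imu.
have rE : pconcat mu (shift (deg mu) (grng g)) = grng g.
  by rewrite -{1}imu shiftP.
have sE : pconcat nu (shift (deg nu) (gsrc g)) = gsrc g.
  by rewrite -{1}inu shiftP.
by rewrite gtripleE e rE s sE.
Qed.

Lemma cylinder2_open mu nu : src mu = src nu -> open (@cylinder2 k L mu nu).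
Proof.
move=> munu; exists [set cylinder2 mu nu]; last by rewrite bigcup_set1.
by move=> _ ->; apply: (finI_from1 id); exists mu, nu.
Qed.

Lemma cylinder2_cat mu nu t : src mu = src nu -> src mu = rng t ->
  @cylinder2 k L (catcomp mu t) (catcomp nu t) `<=` cylinder2 mu nu.
Proof.
move=> munu mt g [x]; rewrite src_comp // => xt gE.
have nt : src nu = rng t by rewrite -munu.
exists (pconcat t x); first by rewrite path_rng_pconcat.
by rewrite gE !pconcat_cat // !deg_comp // toZ_subD.
Qed.

Definition tail_cylinder p q g n : set (path_groupoid L) :=
  cylinder2 (path_init (grng g) (p + n)) (path_init (gsrc g) (q + n)).

Lemma tail_cylinder_mem p q g n : witness p q g -> tail_cylinder p q g n g.
Proof.
move=> /(witnessD n) w; apply/cylinder2P; first exact: witness_src.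
by rewrite !path_init_deg.
Qed.

Lemma tail_cylinder_open p q g n :
  witness p q g -> open (tail_cylinder p q g n).
Proof. by move=> /(witnessD n) w; apply/cylinder2_open/witness_src. Qed.

Lemma tail_cylinder_sub p q g mu nu n : witness p q g ->
  src mu = src nu -> cylinder2 mu nu g -> leN (deg mu) n ->
  tail_cylinder p q g n `<=` cylinder2 mu nu.
Proof.
move=> [d s] munu /cylinder2P-/(_ munu)[[d' s'] imu inu] mun.
have /subNK e : leN (deg mu) (p + n) by exact: leN_addlW.
set r := subN _ _ in e.
(* The leftover degree r is the same on the source leg. *)
have e' : q + n = deg nu + r.
  have dd : p + deg nu = deg mu + q by apply: toZ_sub_eq; rewrite -d -d'.
  apply: (@addNI _ (deg mu)).
  by rewrite addrA -dd [deg nu + r]addrC addrA e addrAC.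
rewrite /tail_cylinder -e e' !path_initD imu inu s'.
by apply: cylinder2_cat; rewrite // path_init_rng -s' path_rng_shift imu.
Qed.

(** The sets containing all sufficiently small tail cylinders form a filter,
and it contains every subbasic neighbourhood by [tail_cylinder_sub]. *)
Lemma nbhs_tail_cylinder p q g (U : set (path_groupoid L)) :
  witness p q g -> nbhs g U <-> exists n, tail_cylinder p q g n `<=` U.
Proof.
move=> w; split=> [|[n nU]]; last first.
  apply: (filterS nU); apply: open_nbhs_nbhs.
  by split; [exact: tail_cylinder_open | exact: tail_cylinder_mem].
rewrite nbhsE => -[_ [[B BF <-] [V BV Vg]] BU].
have [D DF VE] := BF _ BV.
pose F : set_system (path_groupoid L) := [set W |
  exists N, forall n, leN N n -> tail_cylinder p q g n `<=` W].
have FF : Filter F.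
  split=> [|P Q [N PN] [M QM]|P Q PQ [N PN]].
  - by exists 0.
  - exists (N + M) => n NMn h hn; split.
      by apply: PN hn; apply: leN_trans NMn; exact: leN_addr.
    by apply: QM hn; apply: leN_trans NMn; apply: leN_addlW; exact: leN_refl.
  - by exists N => n Nn h /(PN _ Nn) /PQ.
have [N NV] : F V.
  rewrite -VE; apply: filter_bigI => Z ZD.
  have Zg : Z g by move: Vg; rewrite -VE; exact.
  have := DF _ ZD; rewrite inE => -[mu [nu [munu ZE]]].
  exists (deg mu) => n mun; rewrite ZE in Zg *.
  exact: tail_cylinder_sub.
by exists N => h hN; apply: BU; exists V => //; exact: NV (leN_refl _) _ hN.
Qed.

(** * The isotropy and its interior *)

Lemma cylinder2_subIso mu nu : src mu = src nu ->
  cylinder2 mu nu `<=` Iso L <-> cycline_pair mu nu.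
Proof.
move=> munu; split=> [sub|[_ munux] g [x xmu gE]].
  split=> // x xmu; have [g /sub + gE] := cylinder2_in_groupoid munu xmu.
  by rewrite /Iso /grng /gsrc /= gE.
by rewrite /Iso /grng /gsrc /= gE; exact: munux.
Qed.

Lemma interior_IsoP p q g : witness p q g ->
  (Iso L)° g <-> exists n,
    cycline_pair (path_init (grng g) (p + n)) (path_init (gsrc g) (q + n)).
Proof.
move=> w; apply: iff_trans (nbhs_tail_cylinder _ w) _.
by split=> -[n Hn]; exists n; apply/cylinder2_subIso => //;
  exact: witness_src (witnessD n w).
Qed.

Lemma tail_cylinder_inits p q g n h : witness p q g -> tail_cylinder p q g n h ->
  path_init (grng h) (p + n) = path_init (grng g) (p + n) /\
  path_init (gsrc h) (q + n) = path_init (gsrc g) (q + n).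
Proof.
move=> /(witnessD n)/witness_src w /cylinder2P-/(_ w)[_].
by rewrite !path_init_deg.
Qed.

(** Elements of a tail cylinder agree with g on initial segments of any
prescribed length, so range and source of a limit of isotropy elements have the
same initial segments. *)
Lemma closed_Iso : closed (Iso L).
Proof.
move=> g gcl; have [p [q w]] := witness_exists g.
apply: path_init_inj => r.
have [|h [hI hn]] := gcl (tail_cylinder p q g r).
  by apply/(nbhs_tail_cylinder _ w); exists r.
have [rg sg] := tail_cylinder_inits w hn.
have rp : leN r (p + r) by apply: leN_addlW; exact: leN_refl.
have rq : leN r (q + r) by apply: leN_addlW; exact: leN_refl.
by rewrite -(path_init_le rp rg) -(path_init_le rq sg) hI.
Qed.

(** A point of Lambda^infty_{p,q} gives a boundary point of the interior: an
element of Z(x(p+n) mu, x(q+n) mu) is an interior point in the n-th tail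
cylinder. *)
Lemma inf_path_pq_closure p q g : without_sources L ->
  witness p q g -> Iso L g -> inf_path_pq L p q (grng g) ->
  closure (Iso L)° g /\ ~ (Iso L)° g.
Proof.
move=> Lns w gI [_ xpq]; split; last first.
  move=> /(interior_IsoP w)[n]; rewrite -gI.
  by have [] := xpq _ _ n erefl erefl.
move=> U /(nbhs_tail_cylinder _ w)[n nU].
have [_ [mu [rp rq cyc]]] := xpq _ _ n erefl erefl.
have [z zmu] := path_rng_surj Lns (src mu).
have zs : path_rng z = src (catcomp (path_init (grng g) (p + n)) mu).
  by rewrite src_comp.
have [h hZ _] := cylinder2_in_groupoid cyc.1 zs.
exists h; split.
  apply: (filterS (proj2 (cylinder2_subIso cyc.1) cyc)).
  by apply: open_nbhs_nbhs; split=> //; exact: cylinder2_open cyc.1.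
apply: nU; rewrite /tail_cylinder -gI.
by apply: cylinder2_cat hZ; rewrite // -rp.
Qed.

(** Conversely, an interior point h in the n-th tail cylinder of a boundary
point (x, p - q, x) is cut out by a cycline pair, whose legs extend x(p+n)
and x(q+n) by one and the same path. *)
Lemma closure_inf_path_pq p q g : witness p q g ->
  closure (Iso L)° g -> ~ (Iso L)° g -> p <> q /\ inf_path_pq L p q (grng g).
Proof.
move=> w gcl gN.
have gI : grng g = gsrc g.
  by apply: closed_Iso; apply: closureS gcl; exact: interior_subset.
split.
  move=> pq; apply: gN; apply/(interior_IsoP w); exists 0.
  by rewrite -gI pq; split.
split=> [|_ _ n -> ->]; first by rewrite w.2 gI.
have wn := witnessD n w; split.
  by move=> cyc; apply: gN; apply/(interior_IsoP w); exists n; rewrite -gI.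
have [|h [hI hn]] := gcl (tail_cylinder p q g n).
  by apply/(nbhs_tail_cylinder _ w); exists n.
have [rg sg] := tail_cylinder_inits w hn.
have [wh _ _] := proj1 (cylinder2P _ (witness_src wn)) hn.
rewrite !path_init_deg in wh.
have [m] := proj1 (interior_IsoP wh) hI.
rewrite (path_initD _ (p + n)) (path_initD _ (q + n)) rg sg wh.2 -gI => cyc.
exists (path_init (shift (q + n) (gsrc h)) m); split=> //.
  by rewrite path_init_rng -wh.2 path_rng_shift rg.
by rewrite path_init_rng path_rng_shift sg -gI.
Qed.

End PathGroupoid.

Theorem theorem4p4 (k : nat) (L : kgraph k) (k_ge1 : (1 <= k)%N)
    (L_countable : countable [set: mor L])
    (L_row_finite : row_finite L) (L_no_sources : without_sources L) :
  closed ((Iso L)°) <->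
  forall p q : 'Nat^k, p <> q -> inf_path_pq L p q = set0.
Proof.
split=> [cl p q pq|empty g gcl].
  apply/seteqP; split=> // x xpq.
  have xP : exists p' q' : 'Nat^k,
      toZ p - toZ q = toZ p' - toZ q' /\ shift p' x = shift q' x.
    by exists p, q; split=> //; have [] := xpq.
  pose g := @PathGroupoid k L (x, toZ p - toZ q, x) xP.
  have w : witness p q g by split=> //; have [] := xpq.
  have [/cl gin gout] := @inf_path_pq_closure k L p q g L_no_sources w erefl xpq.
  exact: gout gin.
apply: contrapT => gN; have [p [q w]] := witness_exists g.
have [pq] := closure_inf_path_pq w gcl gN.
by rewrite empty.
Qed.
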